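(* For every $i\in\{1,2,3,4\}$ there exist an integer $n\geq2$, a finite-dimensional $\mathbb{Q}$-vector space $E$, operators $R,\sigma\in\operatorname{GL}(E)$ and a flag $0=F_0\subset F_1\subset\cdots\subset F_n=E$ which satisfy the three conditions among (H1), (H2), (H3), (H4) of the context other than (H$i$), but for which at least one of the following conclusions fails: (a) $\Xi\Theta^{k_1}\Xi\cdots\Xi\Theta^{k_M}\Xi=0$ for every $M\geq n$ and all $(k_1,\ldots,k_M)\in\mathbb{Z}^M$; (b) $(\Xi\Theta)^{n-1}\Xi\neq0$; (c) $\mathcal J=\operatorname{rad}\mathcal G$ (the Jacobson radical), $\mathcal J^{\,n}\neq0$ and $\mathcal J^{\,n+1}=0$.
   Context: Given a field $\Bbbk$ (here $\Bbbk=\mathbb{Q}$), a finite-dimensional $\Bbbk$-vector space $E$, an integer $n\geq2$, $R,\sigma\in\operatorname{GL}(E)$ and a flag of subspaces $0=F_0\subset F_1\subset\cdots\subset F_n=E$, set $$C=R+R^{-1},\qquad D=\sigma(R-R^{-1}),$$ and, on $E\oplus E$, $$\Theta=\begin{pmatrix}R^{-1}&0\\ R-R^{-1}&R\end{pmatrix},\qquad \Xi=\begin{pmatrix}0&\sigma\\0&0\end{pmatrix}.$$ Let $\mathcal G=\Bbbk\langle I,\Theta,\Xi\rangle\subseteq\operatorname{End}(E\oplus E)$ be the unital subalgebra generated by $\Theta$ and $\Xi$, and $\mathcal J=\mathcal G\,\Xi\,\mathcal G$ the two-sided ideal generated by $\Xi$. The four conditions are: (H1) $CF_r\subseteq F_r$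 for $1\leq r\leq n$; (H2) $DF_r\subseteq F_{r-1}$ for $1\leq r\leq n$; (H3) $D^{\,n-1}\neq0$; (H4) the algebra $\Bbbk[\Theta,\Theta^{-1}]$ is semisimple. *)

(* Defs.v *)
From HB Require Import structures.
From mathcomp Require Import all_boot all_order all_algebra all_field.

Set Implicit Arguments.
Unset Strict Implicit.
Unset Printing Implicit Defensive.

Import GRing.Theory.

Local Open Scope ring_scope.

(* A falgType is a nonzero ring, so the algebra structure on the endomorphisms
   of V needs V to be nonzero.  The product is composition: (f * g) x = f (g x),
   the opposite of the convention of FalgLfun. *)
Definition endo (K : fieldType) (V : vectType K)
  (V_gt0 : (0 < \dim {:V})%N) := 'End(V).

Section EndoAlgebra.

Variables (K : fieldType) (V : vectType K) (V_gt0 : (0 < \dim {:V})%N).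

HB.instance Definition _ := Vector.on (endo V_gt0).

Fact endo_proper : (0 < dim V)%N. Proof. by rewrite -dimvf. Qed.

HB.instance Definition _ := GRing.Zmodule_isNzRing.Build (endo V_gt0)
  (@comp_lfunA _ _ _ _ _) (@comp_lfun1l _ _ _) (@comp_lfun1r _ _ _)
  (@comp_lfunDl _ _ _ _) (@comp_lfunDr _ _ _ _) (lfun1_neq0 endo_proper).

HB.instance Definition _ := GRing.Lmodule_isLalgebra.Build K (endo V_gt0)
  (fun k f g => @comp_lfunZl _ _ _ _ k f g).

HB.instance Definition _ := GRing.Lalgebra_isAlgebra.Build K (endo V_gt0)
  (fun k f g => @comp_lfunZr _ _ _ _ k f g).

HB.instance Definition _ := Algebra_isFalgebra.Build K (endo V_gt0).

Lemma endo_mulE (f g : endo V_gt0) x : (f * g) x = f (g x).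
Proof. exact: comp_lfunE. Qed.

Lemma endo_1E x : (1 : endo V_gt0) x = x.
Proof. exact: id_lfunE. Qed.

End EndoAlgebra.

Section JacobsonRadical.

Variables (K : fieldType) (aT : falgType K).
Implicit Types A I M : {vspace aT}.

(* Below, A is a subalgebra of aT containing 1; every left ideal of A in the
   ring-theoretic sense is then a K-subspace. *)
Definition left_ideal A I := (I <= A)%VS && (A * I <= I)%VS.

Definition maximal_left_ideal A M :=
  [/\ left_ideal A M, M != A &
      forall I, left_ideal A I -> (M <= I)%VS -> I = M \/ I = A].

Definition jacobson_radical A (x : aT) :=
  x \in A /\ forall M, maximal_left_ideal A M -> x \in M.

(* A finite-dimensional algebra is semisimple when its Jacobson radical is
   zero. *)
Definition semisimple_alg A := forall x, jacobson_radical A x -> x = 0.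

End JacobsonRadical.

Section DirectSum.

Variables (K : fieldType) (E : vectType K) (E_gt0 : (0 < \dim {:E})%N).

Lemma dim_dsum_gt0 : (0 < \dim {: (E * E)%type})%N.
Proof.
have := E_gt0; rewrite !lt0n !dimv_eq0; apply: contraNneq => E20.
apply/eqP/vspaceP => v; rewrite memvf memv0; apply/esym/eqP.
have : (v, 0 : E) \in fullv by exact: memvf.
by rewrite E20 memv0 => /eqP[].
Qed.

(* The operator of E (+) E with block matrix (a b; c d), acting on columns. *)
Definition block_fun (a b c d : endo E_gt0) (x : E * E) : E * E :=
  (a x.1 + b x.2, c x.1 + d x.2).

Definition block (a b c d : endo E_gt0) : endo dim_dsum_gt0 :=
  linfun (block_fun a b c d).

Fact block_fun_linear a b c d : linear (block_fun a b c d).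
Proof.
have lin2 (f g : 'End(E)) k (x y x' y' : E) :
  f (k *: x + x') + g (k *: y + y') = k *: (f x + g y) + (f x' + g y').
  by rewrite !linearP scalerDr addrACA.
by move=> k u v; exact: (congr2 pair (lin2 _ _ _ _ _ _ _) (lin2 _ _ _ _ _ _ _)).
Qed.

HB.instance Definition _ a b c d :=
  GRing.isLinear.Build K (E * E)%type (E * E)%type *:%R (block_fun a b c d)
    (block_fun_linear a b c d).

Lemma blockE a b c d x : block a b c d x = block_fun a b c d x.
Proof. exact: (lfunE (block_fun a b c d)). Qed.

Lemma block1 : block 1 0 0 1 = 1.
Proof.
apply/lfunP => -[x y].
by rewrite endo_1E blockE /block_fun /= !endo_1E !zero_lfunE addr0 add0r.
Qed.

Lemma blockM a b c d a' b' c' d' :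
  block a b c d * block a' b' c' d' =
  block (a * a' + b * c') (a * b' + b * d') (c * a' + d * c') (c * b' + d * d').
Proof.
apply/lfunP => -[x y]; rewrite endo_mulE !blockE /block_fun /=.
have lin2 (f g h k h' k' : endo E_gt0) :
    f (h x + k y) + g (h' x + k' y) =
    (f * h + g * h') x + (f * k + g * k') y.
  by rewrite !linearD !add_lfunE !endo_mulE addrACA.
by rewrite !lin2.
Qed.

End DirectSum.

Section Data.

Variables (K : fieldType) (E : vectType K) (E_gt0 : (0 < \dim {:E})%N).
Variables (n : nat) (R sigma : endo E_gt0) (F : nat -> {vspace E}).

Definition is_flag :=
  [/\ F 0%N = 0%VS, F n = fullv &
      forall r, (r < n)%N -> (F r <= F r.+1)%VS /\ F r <> F r.+1].

Definition opC : endo E_gt0 := R + R^-1.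
Definition opD : endo E_gt0 := sigma * (R - R^-1).

Definition Theta := block R^-1 0 (R - R^-1) R.
Definition Xi := block 0 sigma 0 0.

Lemma Theta_unit : R \is a GRing.unit -> Theta \is a GRing.unit.
Proof.
move=> R_unit; apply/unitrP; exists (block R 0 (R^-1 - R) R^-1).
rewrite !blockM -block1 !(mulr0, mul0r, addr0, add0r) !(mulrBl, mulrBr).
by rewrite !divrr ?mulVr // !addrA !subrK !subrr.
Qed.

Definition algG : {vspace endo (dim_dsum_gt0 E_gt0)} :=
  agenv <<[:: Theta; Xi]>>.

Definition idealJ : {vspace endo (dim_dsum_gt0 E_gt0)} :=
  (algG * <[Xi]> * algG)%VS.

Definition H1 := forall r, (1 <= r <= n)%N -> (opC @: F r <= F r)%VS.
Definition H2 := forall r, (1 <= r <= n)%N -> (opD @: F r <= F r.-1)%VS.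
Definition H3 := opD ^+ n.-1 <> 0.
Definition H4 := semisimple_alg (agenv <<[:: Theta; Theta^-1]>>).

Definition hyp (i : nat) : Prop :=
  match i with 1 => H1 | 2 => H2 | 3 => H3 | _ => H4 end.

Definition concl_a := forall (M : nat) (k : 'I_M -> int),
  (n <= M)%N -> Xi * \prod_(j < M) (Theta ^ k j * Xi) = 0.
Definition concl_b := (Xi * Theta) ^+ n.-1 * Xi <> 0.
Definition concl_c :=
  [/\ forall x, x \in idealJ <-> jacobson_radical algG x,
      (idealJ ^+ n)%VS <> 0%VS & (idealJ ^+ n.+1)%VS = 0%VS].

End Data.

(* Main.v *)
From HB Require Import structures.
Require Import Defs.
From mathcomp Require Import all_boot all_order all_algebra all_field.
From mathcomp Require Import ring lra.

Import GRing.Theory.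

Local Open Scope ring_scope.

(** In the coordinates (x, x + y), Theta is diag(R^-1, R), so (H4) holds as soon
    as R is diagonalizable; and Xi Theta^k Xi ... has a single nonzero block, a
    word in D and polynomials in C followed by sigma.
    - Without (H2): R = 2, sigma = 1, where D = 3/2 is not nilpotent.
    - Without (H3): R = sigma = 1, where D = 0.
    - Without (H4): R = 1 + N with N a nilpotent Jordan block of size 2 and
      sigma = 1, where Theta - 1 is in the radical but not in J.
    - Without (H1): n = 3 and R = diag(1, 2, -2), with sigma such that D is a
      single Jordan block of size 3 but D^2 C D != 0. *)

Lemma invr_uniq {A : unitRingType} {a b : A} :
  a * b = 1 -> b * a = 1 -> a \is a GRing.unit /\ a^-1 = b.
Proof.
move=> ab1 ba1; have a_unit : a \is a GRing.unit by apply/unitrP; exists b.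
by split; rewrite // -[a^-1]mulr1 -ab1 mulKr.
Qed.

(** * Generated subalgebras and the Jacobson radical *)

Section Algebras.

Context {K : fieldType} {aT : falgType K}.
Implicit Types U W M : {vspace aT}.

Lemma agenv_min U W :
  1 \in W -> (U <= W)%VS -> (W * W <= W)%VS -> (agenv U <= W)%VS.
Proof.
move=> W1 sUW sWW; apply: agenv_sub_modl; first by rewrite -memvE.
exact: subv_trans (prodvSl _ sUW) sWW.
Qed.

(* If x is outside a maximal left ideal M, then M + A x = A contains 1 = m + g x,
   so m = 1 - g x is a unit of A lying in M. *)
Lemma jacobson_radical_sqr0 (A : {aspace aT}) x :
  1 \in A -> x \in A -> (forall g, g \in A -> g * x * (g * x) = 0) ->
  jacobson_radical A x.
Proof.
move=> A1 Ax sqr0; split=> // M [/andP[sMA sAM] neqMA maxM].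
(* A product of subspaces is a span of products; since [<[x]>] is a line, the scalars go into [A]
   and one product suffices. *)
have memAx y : y \in (A * <[x]>)%VS -> exists2 g, g \in A & y = g * x.
  suff sAx : (A * <[x]> <= amulr x @: A)%VS.
    by move=> /(subvP sAx)/memv_imgP[g Ag ->]; exists g; rewrite ?lfunE.
  apply/prodvP=> g _ Ag /vlineP[c ->]; rewrite -scalerAr scalerAl.
  by apply/memv_imgP; exists (c *: g); rewrite ?lfunE ?rpredZ.
have AxI : left_ideal A (M + A * <[x]>)%VS.
  rewrite /left_ideal subv_add sMA prodv_sub // -?memvE //= prodvDr prodvA.
  by rewrite prodv_id addvS.
have [eqM | eqA] := maxM _ AxI (addvSl _ _).
  rewrite -eqM; apply: (subvP (addvSr M _)).
  by have := memv_mul A1 (memv_line x); rewrite mul1r.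
case/eqP: neqMA; apply/eqP; rewrite eqEsubv sMA.
have /memv_addP[m Mm [y /memAx[g Ag ->] def1]] : 1 \in (M + A * <[x]>)%VS by rewrite eqA.
have M1 : 1 \in M.
  have -> : 1 = (1 + g * x) * m.
    have -> : m = 1 - g * x by rewrite def1 addrK.
    by rewrite mulrDl mul1r mulrBr mulr1 sqr0 // subr0 subrK.
  by apply: (subvP sAM); rewrite memv_mul // rpredD // memvM.
by apply/subvP=> a Aa; rewrite -[a]mulr1; apply: (subvP sAM); rewrite memv_mul.
Qed.

End Algebras.

(** * Eigenvectors, semisimplicity, and flags of kernels *)

Section Eigen.

Context {K : fieldType} {V : vectType K} {V_gt0 : (0 < \dim {:V})%N}.
Implicit Types (T : endo V_gt0) (v w : V).

Definition eval_at v (T : endo V_gt0) : V := T v.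

Fact eval_at_linear v : linear (eval_at v).
Proof. by move=> k S T; rewrite /eval_at add_lfunE scale_lfunE. Qed.

HB.instance Definition _ v :=
  GRing.isLinear.Build K (endo V_gt0) V *:%R (eval_at v) (eval_at_linear v).

(** Taken as a preimage under evaluation at [w], so that it is a subspace of operators and can be
    compared with generated algebras and ideals. *)
Definition sends_to_line w v : {vspace endo V_gt0} :=
  (linfun (eval_at w) @^-1: <[v]>)%VS.

Lemma sends_to_lineP w v T : reflect (exists c, T w = c *: v) (T \in sends_to_line w v).
Proof. by rewrite -memv_preim lfunE; apply: vlineP. Qed.

Lemma sends_to_line_mul w v :
  (sends_to_line v v * sends_to_line w v <= sends_to_line w v)%VS.
Proof.
apply/prodvP=> S T /sends_to_lineP[c Sv] /sends_to_lineP[d Tw].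
by apply/sends_to_lineP; exists (d * c); rewrite endo_mulE Tw linearZ /= Sv scalerA.
Qed.

(** The zero vector is allowed, so the terms of a decomposition may vanish. *)
Definition eigenvector T v := exists c, T v = c *: v.

(** The operators mapping [v] into its own line form a unital subalgebra, so it is enough to test
    generators. *)
Lemma agenv_eigenvector (X : seq (endo V_gt0)) v :
  {in X, forall T, eigenvector T v} ->
  (agenv <<X>> <= sends_to_line v v)%VS.
Proof.
move=> Xv; apply: agenv_min (sends_to_line_mul _ _).
  by apply/sends_to_lineP; exists 1; rewrite endo_1E scale1r.
by apply/span_subvP=> T /Xv Tv; apply/sends_to_lineP.
Qed.

Definition diagonalizable_endo T :=
  forall v, exists2 s : seq V, {in s, forall w, eigenvector T w} & v = \sum_(w <- s) w.

Lemma eigenvector_inv {T v} : T \is a GRing.unit -> eigenvector T v -> eigenvector T^-1 v.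
Proof.
move=> T_unit [c Tv]; have [-> | v0] := eqVneq v 0; first by exists 0; rewrite linear0 scaler0.
have c0 : c != 0.
  apply: contraNneq v0 => c0; rewrite -(endo_1E V_gt0 v) -(mulVr T_unit) endo_mulE.
  by rewrite Tv c0 scale0r linear0.
exists c^-1; apply: (scalerI c0); rewrite -linearZ /= -Tv -endo_mulE mulVr //.
by rewrite endo_1E scalerA divff // scale1r.
Qed.

(* For an eigenvector v common to the algebra A, the annihilator of v in A is
   a maximal left ideal, since A v is a line. *)
Lemma diagonalizable_semisimple T : T \is a GRing.unit -> diagonalizable_endo T ->
  semisimple_alg (agenv <<[:: T; T^-1]>>).
Proof.
move=> T_unit diagT x [Ax radx]; set A := agenv _ in Ax radx.
have A1 : 1 \in A by rewrite memvE sub1_agenv.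
suff xv0 v : eigenvector T v -> x v = 0.
  apply/lfunP=> v; have [s eigs ->] := diagT v.
  rewrite zero_lfunE linear_sum /= big_seq big1 // => w sw.
  by rewrite xv0 //; apply: eigs.
move=> Tv; have [-> | v0] := eqVneq v 0; first by rewrite linear0.
have eigA y : y \in A -> eigenvector y v.
  move=> Ay; apply/sends_to_lineP; apply: subvP Ay; apply: agenv_eigenvector.
  by move=> S; rewrite !inE => /orP[]/eqP->; last exact: eigenvector_inv.
have annP (y : endo V_gt0) : (y \in lker (linfun (eval_at v))) = (y v == 0).
  by rewrite memv_ker lfunE.
suff /radx : maximal_left_ideal A (A :&: lker (linfun (eval_at v)))%VS.
  by rewrite memv_cap annP => /andP[_ /eqP].
split.
- rewrite /left_ideal capvSl; apply/prodvP=> y z Ay.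
  rewrite !memv_cap !annP endo_mulE => /andP[Az /eqP->].
  by rewrite linear0 eqxx andbT memvM.
- apply: contraNneq v0 => eqA; move: A1; rewrite -{1}eqA memv_cap annP endo_1E.
  by case/andP.
move=> I /andP[sIA sAI] sMI.
case: (boolP (I <= A :&: lker (linfun (eval_at v)))%VS) => [sIM | /subvPn[z Iz]].
  by left; apply/eqP; rewrite eqEsubv sIM.
have Az := subvP sIA z Iz; have [c zv] := eigA z Az.
rewrite memv_cap Az annP zv scaler_eq0 (negPf v0) orbF => c0.
right; apply/eqP; rewrite eqEsubv sIA; apply/subvP=> y Ay; have [d yv] := eigA y Ay.
(* As [z v] is a nonzero multiple of [v], subtracting a multiple of [z] from [y] gives an element
   that kills [v], hence lies in [I]. *)
rewrite -[y](subrK (d / c *: z)); apply: rpredD; last exact: rpredZ.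
apply: (subvP sMI); rewrite memv_cap rpredB ?rpredZ // annP.
by rewrite add_lfunE opp_lfunE scale_lfunE yv zv scalerA divfK // subrr eqxx.
Qed.

(** Inclusions are strict: if [N ^+ r] and [N ^+ r.+1] had the same kernel, then [N ^+ n = 0] would
    force [N ^+ n.-1 = 0]. *)
Lemma is_flag_lker (n : nat) (N : endo V_gt0) :
  N ^+ n = 0 -> N ^+ n.-1 <> 0 -> is_flag n (fun r => lker (N ^+ r)).
Proof.
move=> Nn0 Nn1; split.
- by apply/vspaceP=> v; rewrite memv_ker expr0 endo_1E memv0.
- by apply/vspaceP=> v; rewrite memv_ker Nn0 zero_lfunE eqxx memvf.
move=> r ltrn; split.
  by apply/subvP=> v; rewrite !memv_ker exprS endo_mulE => /eqP->; rewrite linear0.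
have [k def_n] : exists k, n = (r.+1 + k)%N by exists (n - r.+1)%N; rewrite subnKC.
move: Nn0 Nn1; rewrite {}def_n addSn /= -addSn !exprD => Nn0 Nn1 eq_ker.
apply: Nn1; apply/lfunP=> v; rewrite zero_lfunE endo_mulE; apply/eqP.
rewrite -memv_ker eq_ker memv_ker.
by have /lfunP/(_ v) := Nn0; rewrite endo_mulE zero_lfunE => ->.
Qed.

Lemma lker_expr_pred (N : endo V_gt0) r : (0 < r)%N ->
  (N @: lker (N ^+ r)%R <= lker (N ^+ r.-1)%R)%VS.
Proof.
case: r => // r _; apply/subvP=> _ /memv_imgP[v + ->].
by rewrite !memv_ker exprSr endo_mulE.
Qed.

End Eigen.

(** * Words in [Theta] and [Xi], and eigenvectors of [Theta] *)

Section Blocks.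

Context {K : fieldType} {E : vectType K} {E_gt0 : (0 < \dim {:E})%N}.
Implicit Types a R sigma : endo E_gt0.

Lemma block_ur_eq0 a : block 0 a 0 0 = 0 -> a = 0.
Proof.
move=> /lfunP a0; apply/lfunP=> x; have := a0 (0, x).
by rewrite blockE /block_fun /= !zero_lfunE add0r addr0 => -[].
Qed.

(** Computes words that begin with [Xi] from the left: only the lower left block of [Theta]
    contributes. *)
Lemma block_ur_Theta_Xi a R sigma :
  block 0 a 0 0 * (Theta R * Xi sigma) = block 0 (a * (R - R^-1) * sigma) 0 0.
Proof. by rewrite !blockM !(mul0r, mulr0, add0r, addr0) mulrA. Qed.

(** The lower left block of [Theta ^+ 2] is [(R - R^-1) * opC R]; this is how C enters a word. *)
Lemma block_ur_Theta2_Xi a R sigma : R \is a GRing.unit ->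
  block 0 a 0 0 * (Theta R ^+ 2 * Xi sigma) =
  block 0 (a * (R - R^-1) * opC R * sigma) 0 0.
Proof.
move=> R_unit; rewrite expr2 !blockM !(mul0r, mulr0, add0r, addr0) -!mulrA.
congr (block 0 (_ * _) 0 0); rewrite mulrA; congr (_ * _).
by rewrite [RHS]mulrDr addrC; congr (_ + _); rewrite mulrBl mulrBr divrr // mulVr.
Qed.

(** If [R v = c v], then [(v, - v)] and [(0, v)] are eigenvectors of [Theta R], for [R^-1] and [R]
    respectively; and [(x, y) = (x, - x) + (0, x + y)]. *)
Lemma Theta_diagonalizable R : R \is a GRing.unit ->
  diagonalizable_endo R -> diagonalizable_endo (Theta R).
Proof.
move=> R_unit diagR [x y]; have [s eigs def_x] := diagR x.
have [t eigt def_xy] := diagR (x + y).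
exists ([seq (v, - v) | v <- s] ++ [seq (0 : E, v) | v <- t]).
  move=> w; rewrite mem_cat => /orP[] /mapP[v + ->].
    move=> /eigs/(eigenvector_inv R_unit)[c Rv]; exists c.
    rewrite blockE /block_fun /= zero_lfunE addr0 add_lfunE opp_lfunE Rv linearN.
    by rewrite addrAC subrr add0r -scalerN.
  move=> /eigt[c Rv]; exists c.
  by rewrite blockE /block_fun /= zero_lfunE !linear0 !add0r Rv; congr pair; rewrite scaler0.
rewrite big_cat !big_map /=.
have -> : \sum_(v <- s) (v, - v) = (x, - x).
  rewrite {}def_x; elim: s {eigs} => [|v s IHs]; first by rewrite !big_nil oppr0.
  by rewrite !big_cons IHs opprD.
have -> : \sum_(v <- t) (0 : E, v) = (0, x + y).
  rewrite {}def_xy; elim: t {eigt} => [|v t IHt]; first by rewrite !big_nil.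
  by rewrite !big_cons IHt; congr pair; rewrite /= addr0.
by congr pair; rewrite /= ?addr0 // addKr.
Qed.

Lemma Theta_semisimple R :
  R \is a GRing.unit -> diagonalizable_endo R -> H4 R.
Proof.
move=> R_unit diagR; apply: diagonalizable_semisimple; first exact: Theta_unit.
exact: Theta_diagonalizable.
Qed.

Lemma scalar_diagonalizable (c : K) : diagonalizable_endo (c *: 1 : endo E_gt0).
Proof.
move=> v; exists [:: v]; last by rewrite big_seq1.
by move=> _ /[!inE]/eqP->; exists c; rewrite scale_lfunE endo_1E.
Qed.

End Blocks.

Definition counterexample_without (i : nat) : Prop :=
  exists (n : nat) (E : vectType rat) (E_gt0 : (0 < \dim {:E})%N)
         (R sigma : endo E_gt0) (F : nat -> {vspace E}),
    [/\ (2 <= n)%N,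
        R \is a GRing.unit /\ sigma \is a GRing.unit,
        is_flag n F,
        forall j : nat, (1 <= j <= 4)%N -> j <> i -> hyp n R sigma F j &
        [\/ ~ concl_a n R sigma, ~ concl_b n R sigma | ~ concl_c n R sigma]].

(** * Scalar operators and the two-dimensional counterexamples *)

Section Scalar.

Context {K : fieldType} {V : vectType K} {V_gt0 : (0 < \dim {:V})%N}.

Lemma scalar_stable (c : K) (U : {vspace V}) :
  (((c *: 1 : endo V_gt0) : 'End(V)) @: U <= U)%VS.
Proof.
by apply/subvP=> _ /memv_imgP[v Uv ->]; rewrite scale_lfunE endo_1E memvZ.
Qed.

Lemma scalar_inv (c : K) : c != 0 ->
  (c *: 1 : endo V_gt0) \is a GRing.unit /\
  (c *: 1 : endo V_gt0)^-1 = c^-1 *: 1.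
Proof.
by move=> c0; apply: invr_uniq; rewrite -scalerAl mul1r scalerA ?divff ?mulVf // scale1r.
Qed.

End Scalar.

Definition shift_fun (v : rat^o * rat^o) : rat^o * rat^o := (v.2, 0).

Fact shift_linear : linear shift_fun.
Proof. by move=> c u v; congr pair; rewrite /= scaler0 addr0. Qed.

HB.instance Definition _ :=
  GRing.isLinear.Build rat (rat^o * rat^o)%type (rat^o * rat^o)%type *:%R
    shift_fun shift_linear.

(** Hides the concrete plane: later arguments use only the chain f -> e -> 0 and the fact that the
    kernel of [N] is the line of [e]. *)
Lemma exists_jordan_block2 :
  exists (E : vectType rat) (E_gt0 : (0 < \dim {:E})%N) (N : endo E_gt0) (e f : E),
    [/\ e != 0, N f = e, N * N = 0 & forall v, N v = 0 -> exists c, v = c *: e].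
Proof.
have E_gt0 : (0 < \dim {: (rat^o * rat^o)%type})%N.
  by apply: dim_dsum_gt0; rewrite dimvf.
exists _, E_gt0, (linfun shift_fun), (1, 0), (0, 1); split=> //.
- by rewrite lfunE.
- by apply/lfunP=> v; rewrite [RHS]zero_lfunE endo_mulE !lfunE.
move=> [x y]; rewrite lfunE => -[->]; exists x.
by congr pair; rewrite /= ?scaler0 // /GRing.scale /= mulr1.
Qed.

(** Conclusion (a) fails at M = n = 2: the block of Xi Theta Xi Theta Xi is D^2 = 9/4. Here [N] only
    supplies a flag, which the scalar C preserves. *)
Lemma counterexample_without_H2 : counterexample_without 2.
Proof.
have [E [E_gt0 [N [e [f [e0 Nf NN _]]]]]] := exists_jordan_block2.
have N0 : N <> 0 by move=> N0; rewrite -Nf N0 zero_lfunE eqxx in e0.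
have [R_unit R_inv] := @scalar_inv _ _ E_gt0 2%:R isT.
have D_def : (2%:R *: 1 - (2%:R *: 1)^-1 : endo E_gt0) = 3%:R / 2%:R *: 1.
  by rewrite R_inv -scalerBl.
exists 2, E, E_gt0, (2%:R *: 1), 1, (fun r => lker (N ^+ r)); split=> //.
- by split; rewrite ?unitr1.
- by apply: is_flag_lker; rewrite ?expr2 ?expr1.
- case=> [|[|[|[|[|j]]]]] // _ _ /=.
  + by move=> r _; rewrite /opC R_inv -scalerDl; apply: scalar_stable.
  + rewrite /H3 expr1 /opD mul1r D_def => /eqP; rewrite scaler_eq0 /=.
    by rewrite oner_eq0.
  + by apply: Theta_semisimple R_unit _; apply: scalar_diagonalizable.
apply: Or31 => /(_ 2 (fun _ => 1) isT).
rewrite !big_ord_recl big_ord0 mulr1 expr1z {1}/Xi.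
rewrite (mulrA (block _ _ _ _)) !block_ur_Theta_Xi D_def.
move/block_ur_eq0/eqP; rewrite !mulr1 mul1r -scalerAl mul1r scalerA scaler_eq0 /=.
by rewrite oner_eq0.
Qed.

(** Conclusion (b) fails, since the block of Xi Theta Xi is D sigma = 0. *)
Lemma counterexample_without_H3 : counterexample_without 3.
Proof.
have [E [E_gt0 [N [e [f [e0 Nf NN _]]]]]] := exists_jordan_block2.
have N0 : N <> 0 by move=> N0; rewrite -Nf N0 zero_lfunE eqxx in e0.
exists 2, E, E_gt0, 1, 1, (fun r => lker (N ^+ r)); split=> //.
- by split; rewrite unitr1.
- by apply: is_flag_lker; rewrite ?expr2 ?expr1.
- case=> [|[|[|[|[|j]]]]] // _ _ /=.
  + move=> r _; rewrite /opC invr1 -[1 + 1]/(1 *+ 2) -scaler_nat.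
    exact: scalar_stable.
  + move=> r _; rewrite /opD invr1 subrr mulr0.
    by apply/subvP=> _ /memv_imgP[v _ ->]; rewrite zero_lfunE mem0v.
  + apply: Theta_semisimple; rewrite ?unitr1 // -[1]scale1r.
    exact: scalar_diagonalizable.
apply: Or32; rewrite /concl_b expr1 -mulrA {1}/Xi block_ur_Theta_Xi invr1 subrr.
rewrite mulr0 mul0r; apply; apply/lfunP=> v.
by rewrite blockE zero_lfunE /block_fun !zero_lfunE !addr0.
Qed.

(* T = Theta - 1 lies in the radical but not in J.  With B = N (+) N central
   in G and T = T0 B, one has (g T)^2 = g T0 g B^2 T0 = 0; and every element of
   J sends (f, 0) into the line spanned by (e, 0), whereas T (f, 0) = (- e, 2 e). *)
Lemma counterexample_without_H4 : counterexample_without 4.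
Proof.
have [E [E_gt0 [N [e [f [e0 Nf NN kerN]]]]]] := exists_jordan_block2.
have N0 : N <> 0 by move=> N0; rewrite -Nf N0 zero_lfunE eqxx in e0.
have Ne : N e = 0 by rewrite -Nf -endo_mulE NN zero_lfunE.
have [R_unit R_inv] : (1 + N) \is a GRing.unit /\ (1 + N)^-1 = 1 - N.
  apply: invr_uniq; first by rewrite mulrBr mulr1 mulrDl mul1r NN addr0 addrK.
  by rewrite mulrDr mulr1 mulrBl mul1r NN subr0 subrK.
have s_def : 1 + N - (1 + N)^-1 = 2%:R *: N.
  by rewrite R_inv opprB addrC addrA subrK scaler_nat mulr2n.
exists 2, E, E_gt0, (1 + N), 1, (fun r => lker (N ^+ r)); split=> //.
- by split; rewrite ?unitr1.
- by apply: is_flag_lker; rewrite ?expr2 ?expr1.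
- case=> [|[|[|[|[|j]]]]] // _ _ /=.
  + move=> r _; rewrite /opC R_inv addrACA subrr addr0 -[1 + 1]/(1 *+ 2) -scaler_nat.
    exact: scalar_stable.
  + move=> r /andP[r0 _]; rewrite /opD mul1r s_def.
    apply/subvP=> _ /memv_imgP[v Fv ->]; rewrite scale_lfunE memvZ //.
    by apply: (subvP (lker_expr_pred N r r0)); apply: memv_img.
  + rewrite /H3 expr1 /opD mul1r s_def => /eqP; rewrite scaler_eq0 /=.
    by move/eqP.
apply: Or33 => -[J_rad _ _]; set T := Theta (1 + N) - 1.
set G := algG (1 + N) 1 in J_rad.
pose B := block N 0 0 N; pose T0 := block (- 1) 0 2%:R 1 : endo (dim_dsum_gt0 E_gt0).
have G1 : 1 \in G by rewrite memvE sub1_agenv.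
have TE x y : T (x, y) = (- N x, 2%:R *: N x + N y).
  rewrite add_lfunE opp_lfunE endo_1E blockE /block_fun /= s_def R_inv.
  rewrite !add_lfunE opp_lfunE !endo_1E zero_lfunE addr0 scale_lfunE.
  by congr pair; rewrite /= ?addrA; [rewrite addrAC subrr add0r | rewrite addrAC addrK addrC].
have T_B : T = T0 * B.
  apply/lfunP=> -[x y]; rewrite TE blockM blockE /block_fun /=.
  rewrite !(mul0r, mulr0, addr0, add0r, mulN1r, mul1r) mulr_natl -scaler_nat.
  by rewrite opp_lfunE zero_lfunE addr0 scale_lfunE.
have BB : B * B = 0.
  rewrite /B blockM !(mul0r, mulr0, addr0, add0r) NN.
  by apply/lfunP=> v; rewrite blockE zero_lfunE /block_fun !zero_lfunE !addr0.
have comT0 : B * T0 = T0 * B.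
  by rewrite !blockM !(mul0r, mulr0, addr0, add0r);
     rewrite !(mulrN, mulNr, mulr1, mul1r, mulr_natl, mulr_natr).
have genP S : S \in [:: Theta (1 + N); Xi 1] -> S = 1 + T \/ S = Xi 1.
  by rewrite !inE => /orP[]/eqP->; [left; rewrite [1 + T]addrC subrK | right].
have G_B g : g \in G -> g * B = B * g.
  suff sGB : (G <= 'C[B])%VS by move=> /(subvP sGB)/cent1vP.
  apply: agenv_min; rewrite ?prodv_id ?memv_algid //.
    by apply/cent1vP; rewrite mul1r mulr1.
  apply/span_subvP=> S /genP[] ->; apply/cent1vP.
    by rewrite mulrDl mulrDr mul1r mulr1 T_B -{1}comT0 !mulrA comT0.
  by rewrite !blockM !(mul0r, mulr0, addr0, add0r, mul1r, mulr1).
have T_G : T \in G.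
  rewrite rpredB //; apply: (subvP (sub_agenv _)); apply: memv_span.
  exact: mem_head.
have G_line : (G <= sends_to_line (e, 0%R) (e, 0%R))%VS.
  apply: agenv_eigenvector => S /genP[] ->.
    exists 1; rewrite add_lfunE endo_1E TE Ne.
    by congr pair; rewrite /= scale1r ?scaler0 ?linear0 ?oppr0 ?addr0.
  exists 0; rewrite blockE /block_fun /= !zero_lfunE endo_1E scale0r addr0 //.
have J_line : (idealJ (1 + N)%R 1%R <= sends_to_line (f, 0%R) (e, 0%R))%VS.
  rewrite /idealJ -prodvA; apply: subv_trans (sends_to_line_mul _ _).
  apply: prodvS => //; apply/prodvP=> _ g /vlineP[c ->] Gg.
  apply/sends_to_lineP; case def_v: (g (f, 0)) => [p q].
  have [d ge] := sends_to_lineP _ _ _ (subvP G_line g Gg).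
  (* [B (p, q) = g (B (f, 0)) = g (e, 0)] lies on the line of [(e, 0)], so its second component
     [N q] vanishes. Then [Xi 1] sends [(p, q)] to [(q, 0)], on that same line. *)
  have /kerN[b def_q] : N q = 0.
    have /lfunP/(_ (f, 0)) := G_B g Gg; rewrite !endo_mulE def_v !blockE /block_fun /=.
    rewrite Nf !linear0 !zero_lfunE !addr0 add0r ge => -[_ <-]; by rewrite scaler0.
  exists (c * b); rewrite -scalerAl scale_lfunE endo_mulE def_v blockE /block_fun /=.
  rewrite !zero_lfunE endo_1E !add0r def_q.
  by congr pair; rewrite /= ?scaler0 // scalerA.
have /J_rad/(subvP J_line)/sends_to_lineP[c] : jacobson_radical G T.
  apply: jacobson_radical_sqr0 => // g Gg; rewrite T_B -!mulrA.
  by rewrite (mulrA B g) -G_B // -!mulrA (mulrA B T0) comT0 -!mulrA BB !mulr0.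
rewrite TE => -[_]; rewrite scaler0 linear0 addr0 Nf => /eqP.
by rewrite scaler_eq0 (negPf e0).
Qed.

(** * The three-dimensional counterexample, with explicit matrices *)

Definition mx3_fun (a b c v : rat^o * rat^o * rat^o) : rat^o * rat^o * rat^o :=
  let dot r := r.1.1 * v.1.1 + r.1.2 * v.1.2 + r.2 * v.2 in (dot a, dot b, dot c).

Fact mx3_linear a b c : linear (mx3_fun a b c).
Proof.
move=> k u v.
apply: (congr2 pair (congr2 pair _ _) _); rewrite /= /GRing.scale /=; ring.
Qed.

HB.instance Definition _ a b c :=
  GRing.isLinear.Build rat (rat^o * rat^o * rat^o)%type
    (rat^o * rat^o * rat^o)%type *:%R (mx3_fun a b c) (mx3_linear a b c).

Lemma dim3_gt0 : (0 < \dim {: (rat^o * rat^o * rat^o)%type})%N.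
Proof. by rewrite dimvf. Qed.

(** The arguments are the rows of the matrix, which acts on columns. *)
Definition mx3 a b c : endo dim3_gt0 := linfun (mx3_fun a b c).

Lemma mx3E a b c v : mx3 a b c v = mx3_fun a b c v.
Proof. exact: (lfunE (mx3_fun a b c)). Qed.

Lemma diag3_diagonalizable (a b c : rat) :
  diagonalizable_endo (mx3 (a, 0, 0) (0, b, 0) (0, 0, c)).
Proof.
move=> [[x y] z]; exists [:: (x, 0, 0); (0, y, 0); (0, 0, z)].
  move=> v; rewrite !inE => /or3P[] /eqP->; [exists a | exists b | exists c];
    rewrite mx3E; apply: (congr2 pair (congr2 pair _ _) _);
    by rewrite /= ?scaler0 ?(mul0r, mulr0, addr0, add0r).
rewrite !big_cons big_nil addr0.
by apply: (congr2 pair (congr2 pair _ _) _); rewrite /= ?(addr0, add0r).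
Qed.

(* D is a single nilpotent Jordan block, so the flag must be F_r = ker D^r;
   C does not preserve F_2 = {y = z}, and D^2 C D != 0 although D^3 = 0. *)
Lemma counterexample_without_H1 : counterexample_without 1.
Proof.
pose R := mx3 (1, 0, 0) (0, 2, 0) (0, 0, -2).
(* R - R^-1 = diag(0, 3/2, -3/2), so D only sees the last two columns of [sigma]. They give the
   chain e2 -> 3/2 (e2 + e3) -> 9/4 e1 -> 0; the first column makes [sigma] invertible. *)
pose sigma := mx3 (0, 0, -1) (1, 1, 1) (0, 1, 1).
have [R_unit R_inv] : R \is a GRing.unit /\
    R^-1 = mx3 (1, 0, 0) (0, 1 / 2, 0) (0, 0, - 1 / 2).
  by apply: invr_uniq; apply/lfunP=> -[[x y] z]; rewrite endo_mulE endo_1E !mx3E;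
     apply: (congr2 pair (congr2 pair _ _) _); rewrite /=; field.
have [sigma_unit _] : sigma \is a GRing.unit /\
    sigma^-1 = mx3 (0, 1, -1) (1, 0, 1) (-1, 0, 0).
  by apply: invr_uniq; apply/lfunP=> -[[x y] z]; rewrite endo_mulE endo_1E !mx3E;
     apply: (congr2 pair (congr2 pair _ _) _); rewrite /=; ring.
have DE x y z : opD R sigma (x, y, z) = (3 / 2 * z, 3 / 2 * (y - z), 3 / 2 * (y - z)).
  rewrite /opD R_inv endo_mulE add_lfunE opp_lfunE !mx3E.
  by apply: (congr2 pair (congr2 pair _ _) _); rewrite /=; field.
have CE x y z : opC R (x, y, z) = (2 * x, 5 / 2 * y, - 5 / 2 * z).
  rewrite /opC R_inv add_lfunE !mx3E.
  by apply: (congr2 pair (congr2 pair _ _) _); rewrite /=; field.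
move defD: (opD R sigma) DE => D DE.
have D3 : D ^+ 3 = 0.
  apply/lfunP=> -[[x y] z]; rewrite zero_lfunE !exprS expr0 mulr1 !endo_mulE !DE.
  by apply: (congr2 pair (congr2 pair _ _) _); rewrite /=; field.
have D2 : D ^+ 2 <> 0.
  move=> /lfunP/(_ (0, 1, 0)); rewrite zero_lfunE expr2 endo_mulE !DE.
  by move/(congr1 (fun v => v.1.1)) => /=; lra.
exists 3, _, dim3_gt0, R, sigma, (fun r => lker (D ^+ r)); split=> //.
- exact: is_flag_lker.
- case=> [|[|[|[|[|j]]]]] // _ _ //.
  + by move=> r /andP[r0 _]; rewrite defD; apply: lker_expr_pred.
  + by rewrite /= /H3 defD.
  + by apply: Theta_semisimple; last exact: diag3_diagonalizable.
(* The word Xi Theta Xi Theta^2 Xi Theta Xi has block D^2 C D sigma: the middle square inserts C. *)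
apply: Or31 => /(_ 3 (fun j => if val j == 1 then 2 else 1)%N isT).
rewrite !big_ord_recl big_ord0 mulr1 /= expr1z {1}/Xi.
rewrite (mulrA (block _ _ _ _)) block_ur_Theta_Xi.
rewrite (mulrA (block _ _ _ _)) block_ur_Theta2_Xi // block_ur_Theta_Xi.
rewrite -!(mulrA _ _ (_ - _)) -/(opD R sigma) defD => /block_ur_eq0.
move/(congr1 (fun a => a * sigma^-1)); rewrite mulrK // mul0r.
(* D^2 C D sends e2 to 135/8 e1. *)
move/lfunP/(_ (0, 1, 0)); rewrite zero_lfunE !endo_mulE !DE CE !DE.
by move/(congr1 (fun v => v.1.1)) => /=; lra.
Qed.

Theorem theorem7p5 (i : nat) (hi : (1 <= i <= 4)%N) :
  exists (n : nat) (E : vectType rat) (E_gt0 : (0 < \dim {:E})%N)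
         (R sigma : endo E_gt0) (F : nat -> {vspace E}),
    [/\ (2 <= n)%N,
        R \is a GRing.unit /\ sigma \is a GRing.unit,
        is_flag n F,
        forall j : nat, (1 <= j <= 4)%N -> j <> i -> hyp n R sigma F j &
        [\/ ~ concl_a n R sigma, ~ concl_b n R sigma | ~ concl_c n R sigma]].
Proof.
case: i hi => [|[|[|[|[|i]]]]] // _.
- exact: counterexample_without_H1.
- exact: counterexample_without_H2.
- exact: counterexample_without_H3.
- exact: counterexample_without_H4.
Qed.
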